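(* Let $n\ge 1$, $1\le r\le n$, and let $F:\mathbb{R}^{n\times n}\to\mathbb{R}$ be twice continuously differentiable, $\mu_F$-strongly convex and $L_F$-smooth. Let $f:\mathbb{R}^{n\times r}\to\mathbb{R}$ be defined by $f(X)=F(XX^T)$. For $\alpha,\sigma>0$ let $$h_N(X)=\frac{\alpha}{4}\|X\|^4+\frac{\sigma}{2}\|X\|^2,\qquad X\in\mathbb{R}^{n\times r}.$$ If $\alpha\ge 6L_F$ and $\sigma\ge 2\|\nabla F(0)\|$, then $f$ is $1$-smooth relative to $h_N$.
   Context: $\|\cdot\|$ is the Frobenius norm and $\langle X,Y\rangle=\mathrm{Tr}(X^TY)$ the associated inner product on matrices; gradients are taken with respect to this inner product. $F$ is $\mu_F$-strongly convex and $L_F$-smooth, with constants $0\le\mu_F\le L_F$, means that for all $X,Y\in\mathbb{R}^{n\times n}$, $$\langle\nabla F(X)-\nabla F(Y),X-Y\rangle\ge\mu_F\|X-Y\|^2,\qquad \|\nabla F(X)-\nabla F(Y)\|\le L_F\|X-Y\|.$$ For a differentiable strictly convex function $h:\mathbb{R}^{n\times r}\to\mathbb{R}$ (a distance kernel), the Bregman distance is $D_h(X,Y)=h(X)-h(Y)-\langle\nabla h(Y),X-Y\rangle$. A differentiable $f:\mathbb{R}^{n\times r}\to\mathbb{R}$ is $L$-smooth relative to $h$ (with $L>0$) if for all $X,Y\in\mathbb{R}^{n\times r}$, $$f(X)\le f(Y)+\langle\nabla f(Y),X-Y\rangle+L\,D_h(X,Y).$$ *)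

(* Defs.v *)
From HB Require Import structures.
From mathcomp Require Import all_boot all_order all_algebra.
From mathcomp Require Import all_classical all_reals all_analysis.

Set Implicit Arguments.
Unset Strict Implicit.
Unset Printing Implicit Defensive.

Import Order.TTheory GRing.Theory Num.Theory.
Import numFieldNormedType.Exports.

Local Open Scope classical_set_scope.
Local Open Scope ring_scope.

(* The library norm `|X| on matrices is the entrywise maximum; it is only used
   for the topology and the notion of differentiability, which do not depend
   on the choice of a norm on a finite-dimensional space. *)

Definition frob_inner (R : realType) (m n : nat) (X Y : 'M[R]_(m, n)) : R :=
  \tr (X^T *m Y).

Definition frob_norm (R : realType) (m n : nat) (X : 'M[R]_(m, n)) : R :=
  Num.sqrt (frob_inner X X).

(* The delta_mx i j form an orthonormal basis for frob_inner, so this is the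
   Riesz representative of the differential: see [frob_inner_grad]. *)
Definition grad (R : realType) (m n : nat) (f : 'M[R]_(m, n) -> R)
    (X : 'M[R]_(m, n)) : 'M[R]_(m, n) :=
  \matrix_(i < m, j < n) 'd f X (delta_mx i j).

Lemma frob_inner_grad (R : realType) (m n : nat) (f : 'M[R]_(m, n) -> R)
    (X V : 'M[R]_(m, n)) :
  frob_inner (grad f X) V = 'd f X V.
Proof.
rewrite [in RHS](matrix_sum_delta V) linear_sum /frob_inner /mxtrace.
under eq_bigr do rewrite mxE.
rewrite exchange_big /=; apply: eq_bigr => i _.
rewrite linear_sum; apply: eq_bigr => j _.
by rewrite !mxE linearZ /= mulrC.
Qed.

(* In finite dimension, continuity of x |-> 'd g x in operator norm is
   continuity of x |-> 'd g x v for every v. *)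
Definition C1 (R : realType) (m n p q : nat)
    (g : 'M[R]_(m, n) -> 'M[R]_(p, q)) : Prop :=
  (forall X, differentiable g X) /\
  (forall V, continuous (fun X => 'd g X V)).

(* A scalar function is C^2 iff it is differentiable with a C^1 gradient. *)
Definition C2 (R : realType) (m n : nat) (f : 'M[R]_(m, n) -> R) : Prop :=
  (forall X, differentiable f X) /\ C1 (grad f).

Definition strongly_convex (R : realType) (m n : nat) (mu : R)
    (F : 'M[R]_(m, n) -> R) : Prop :=
  forall X Y, mu * frob_norm (X - Y) ^+ 2 <=
              frob_inner (grad F X - grad F Y) (X - Y).

Definition smooth (R : realType) (m n : nat) (L : R)
    (F : 'M[R]_(m, n) -> R) : Prop :=
  forall X Y, frob_norm (grad F X - grad F Y) <= L * frob_norm (X - Y).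

Definition strictly_convex (R : realType) (m n : nat)
    (h : 'M[R]_(m, n) -> R) : Prop :=
  forall X Y (t : R), X != Y -> 0 < t < 1 ->
    h (t *: X + (1 - t) *: Y) < t * h X + (1 - t) * h Y.

Definition distance_kernel (R : realType) (m n : nat)
    (h : 'M[R]_(m, n) -> R) : Prop :=
  (forall X, differentiable h X) /\ strictly_convex h.

Definition bregman (R : realType) (m n : nat) (h : 'M[R]_(m, n) -> R)
    (X Y : 'M[R]_(m, n)) : R :=
  h X - h Y - frob_inner (grad h Y) (X - Y).

Definition relatively_smooth (R : realType) (m n : nat) (L : R)
    (h f : 'M[R]_(m, n) -> R) : Prop :=
  [/\ 0 < L,
      distance_kernel h,
      (forall X, differentiable f X) &
      forall X Y, f X <= f Y + frob_inner (grad f Y) (X - Y) +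
                         L * bregman h X Y].

Definition hN (R : realType) (n r : nat) (alpha sigma : R)
    (X : 'M[R]_(n, r)) : R :=
  alpha / 4 * frob_norm X ^+ 4 + sigma / 2 * frob_norm X ^+ 2.

(* Main.v *)
Require Import Defs.
From HB Require Import structures.
From mathcomp Require Import all_boot all_order all_algebra.
From mathcomp Require Import all_classical all_reals all_analysis.
From mathcomp Require Import ring lra.

Import Order.TTheory GRing.Theory Num.Theory.
Import numFieldNormedType.Exports.

Local Open Scope classical_set_scope.
Local Open Scope ring_scope.

(** Put [V = X - Y] and [W = X X^T - Y Y^T].  Since [F] is [LF]-smooth, it lies
    below its quadratic upper model at [Y Y^T] ([smooth_descent]), so
    [f X <= f Y + <g, W> + LF / 2 * |W|^2] where [g = grad F (Y Y^T)].  Now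
    [W = (Y V^T + V Y^T) + V V^T], and the first summand is the differential
    of [Z |-> Z Z^T] at [Y] in direction [V]; by the chain rule its product
    with [g] is [<grad f Y, V>].  It remains to show
    [<g, V V^T> + LF / 2 * |W|^2 <= D_hN(X, Y)].

    The right-hand side is computed exactly in [bregman_hN]: with
    [y = |Y|^2], [c = <Y, V>] and [v = |V|^2] it is
    [alpha * ((2 c + v)^2 / 4 + y v / 2) + sigma / 2 * v].  On the left,
    - [<g, V V^T> <= |g| v <= (|grad F 0| + LF y) v] by the Lipschitz bound
      between [Y Y^T] and [0]; the [grad F 0] part is paid by [sigma];
    - [|W|^2 <= 3 (2 c + v)^2 + 4 y v] ([gram_shift_le]).  The plain
      triangle inequality [|W| <= 2 |Y| |V| + |V|^2] is too weak here, because
      [2 c + v = |X|^2 - |Y|^2] can vanish; one uses instead that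
      [W = M V^T + V M^T] for the midpoint [M] of [X] and [Y].

    The [LF] part of the left-hand side is then at most
    [6 LF ((2 c + v)^2 / 4 + y v / 2)], which is paid by [alpha >= 6 LF]. *)

(** * The Frobenius inner product and norm *)

Section Frobenius.
Context {R : realType}.

Section InnerProduct.
Context {m n : nat}.
Implicit Types (X Y Z : 'M[R]_(m, n)) (a : R).

Lemma frob_innerE X Y : frob_inner X Y = \sum_i \sum_j X i j * Y i j.
Proof.
rewrite /frob_inner /mxtrace exchange_big /=.
by apply: eq_bigr => i _; rewrite mxE; apply: eq_bigr => j _; rewrite mxE.
Qed.

Lemma frob_innerC X Y : frob_inner X Y = frob_inner Y X.
Proof.
by rewrite !frob_innerE; do 2!apply: eq_bigr => ? _; rewrite mulrC.
Qed.

Lemma frob_innerDr X Y Z :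
  frob_inner X (Y + Z) = frob_inner X Y + frob_inner X Z.
Proof. by rewrite /frob_inner mulmxDr mxtraceD. Qed.

Lemma frob_innerZr a X Y : frob_inner X (a *: Y) = a * frob_inner X Y.
Proof. by rewrite /frob_inner -scalemxAr mxtraceZ. Qed.

Lemma frob_innerDl X Y Z :
  frob_inner (X + Y) Z = frob_inner X Z + frob_inner Y Z.
Proof. by rewrite !(frob_innerC _ Z) frob_innerDr. Qed.

Lemma frob_innerZl a X Y : frob_inner (a *: X) Y = a * frob_inner X Y.
Proof. by rewrite !(frob_innerC _ Y) frob_innerZr. Qed.

Lemma frob_innerNr X Y : frob_inner X (- Y) = - frob_inner X Y.
Proof. by rewrite -scaleN1r frob_innerZr mulN1r. Qed.

Lemma frob_innerNl X Y : frob_inner (- X) Y = - frob_inner X Y.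
Proof. by rewrite !(frob_innerC _ Y) frob_innerNr. Qed.

Definition frob_inner_lin := (frob_innerDl, frob_innerDr, frob_innerNl,
  frob_innerNr, frob_innerZl, frob_innerZr).

Lemma frob_inner_ge0 X : 0 <= frob_inner X X.
Proof. by rewrite frob_innerE; do 2!apply: sumr_ge0 => ? _; exact: sqr_ge0. Qed.

Lemma frob_inner_eq0 X : (frob_inner X X == 0) = (X == 0).
Proof.
apply/idP/eqP => [|->]; last by rewrite /frob_inner mulmx0 mxtrace0.
rewrite frob_innerE psumr_eq0 => [/allP X0|i _]; last first.
  by apply: sumr_ge0 => ? _; exact: sqr_ge0.
apply/matrixP => i j; rewrite mxE.
have := X0 i (mem_index_enum i); rewrite psumr_eq0 => [/allP Xi0|? _]; last first.
  exact: sqr_ge0.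
by have := Xi0 j (mem_index_enum j); rewrite /= mulf_eq0 orbb => /eqP.
Qed.

Lemma frob_norm_ge0 X : 0 <= frob_norm X.
Proof. exact: sqrtr_ge0. Qed.

Lemma sqr_frob_norm X : frob_norm X ^+ 2 = frob_inner X X.
Proof. by rewrite sqr_sqrtr// frob_inner_ge0. Qed.

Lemma frob_normZ a X : 0 <= a -> frob_norm (a *: X) = a * frob_norm X.
Proof.
move=> a0; rewrite /frob_norm frob_innerZl frob_innerZr mulrA -expr2.
by rewrite sqrtrM ?sqr_ge0// sqrtr_sqr ger0_norm.
Qed.

(** Cauchy-Schwarz: positivity of the square of [|Y|^2 X - <X, Y> Y], which is
    [|Y|^2] times the wanted difference. *)
Lemma frob_inner_sqr_le X Y :
  frob_inner X Y ^+ 2 <= frob_inner X X * frob_inner Y Y.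
Proof.
have [/eqP|Y0] := eqVneq (frob_inner Y Y) 0.
  rewrite frob_inner_eq0 => /eqP ->.
  by rewrite /frob_inner !mulmx0 mxtrace0 expr0n mulr0.
have := frob_inner_ge0 (frob_inner Y Y *: X - frob_inner X Y *: Y).
rewrite !frob_inner_lin (frob_innerC Y X).
have Y_gt0 : 0 < frob_inner Y Y by rewrite lt_def Y0 frob_inner_ge0.
move=> le0.
rewrite -subr_ge0 -(pmulr_rge0 _ Y_gt0).
by apply: le_trans le0 _; rewrite le_eqVlt; apply/orP; left; apply/eqP; ring.
Qed.

Lemma frob_inner_le X Y : frob_inner X Y <= frob_norm X * frob_norm Y.
Proof.
rewrite (le_trans (ler_norm _))// -ler_sqr ?nnegrE ?mulr_ge0 ?frob_norm_ge0//.
by rewrite real_normK ?num_real// exprMn !sqr_frob_norm frob_inner_sqr_le.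
Qed.

Lemma frob_normD X Y : frob_norm (X + Y) <= frob_norm X + frob_norm Y.
Proof.
rewrite -ler_sqr ?nnegrE ?addr_ge0 ?frob_norm_ge0//.
rewrite sqrrD !sqr_frob_norm !frob_inner_lin (frob_innerC Y X).
have := frob_inner_le X Y; lra.
Qed.

End InnerProduct.

Lemma frob_inner_trmx m n (X Y : 'M[R]_(m, n)) :
  frob_inner X^T Y^T = frob_inner X Y.
Proof.
by rewrite !frob_innerE exchange_big; do 2!apply: eq_bigr => ? _; rewrite !mxE.
Qed.

(** Each entry of [A *m B] is the inner product of a row of [A] and a column of
    [B]; apply Cauchy-Schwarz entry by entry and sum. *)
Lemma frob_norm_mulmx_le m n p (A : 'M[R]_(m, n)) (B : 'M[R]_(n, p)) :
  frob_norm (A *m B) <= frob_norm A * frob_norm B.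
Proof.
rewrite -ler_sqr ?nnegrE ?mulr_ge0 ?frob_norm_ge0// exprMn !sqr_frob_norm.
rewrite (frob_innerE A) -(frob_inner_trmx _ _ B) (frob_innerE B^T) mulr_suml.
rewrite frob_innerE; apply: ler_sum => i _; rewrite mulr_sumr.
apply: ler_sum => j _; have := frob_inner_sqr_le (row i A) (row j B^T).
rewrite !frob_innerE !big_ord1 -expr2 !mxE.
by congr (_ ^+ 2 <= _ * _); apply: eq_bigr => k _; rewrite !mxE.
Qed.

Lemma frob_norm_trmx m n (X : 'M[R]_(m, n)) : frob_norm X^T = frob_norm X.
Proof. by rewrite /frob_norm frob_inner_trmx. Qed.

Lemma frob_norm_sym_le n r (M V : 'M[R]_(n, r)) :
  frob_norm (M *m V^T + V *m M^T) <= 2 * (frob_norm M * frob_norm V).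
Proof.
apply: le_trans (frob_normD _ _) _.
have := frob_norm_mulmx_le _ _ _ M V^T; have := frob_norm_mulmx_le _ _ _ V M^T.
rewrite !frob_norm_trmx; lra.
Qed.

End Frobenius.

(** * Differentials and the descent lemma *)

Section Differentials.
Context {R : realType}.

Lemma is_diff_sum (V W : normedModType R) k (f df : 'I_k -> V -> W) (x : V) :
  (forall i, is_diff x (f i) (df i)) ->
  is_diff x (\sum_(i < k) f i) (\sum_(i < k) df i).
Proof.
by elim/big_ind2 : _ => // [|] *; [exact: is_diff_cst|exact: is_diffD].
Qed.

(** Coordinates are the building blocks: quadratic maps on matrices are sums of
    products of two coordinates, so the sum and product rules do the rest. *)
Lemma is_diff_coord m n (M : 'M[R]_(m, n)) i j :
  is_diff M (fun N : 'M[R]_(m, n) => N i j : R) (fun N => N i j).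
Proof.
pose coord : 'M[R]_(m, n) -> R := fun N => N i j.
have lin_coord : linear coord.
  by rewrite /coord => a U V; rewrite !mxE.
pose coordM := GRing.isLinear.Build _ _ _ _ _ lin_coord.
pose coordL : {linear 'M[R]_(m, n) -> R} := HB.pack coord coordM.
apply: DiffDef; first exact: differentiable_coord.
exact: (@diff_lin _ _ _ coordL _ (@coord_continuous _ _ _ i j)).
Qed.

Lemma is_diff_frob_sqr m n (X : 'M[R]_(m, n)) :
  is_diff X (fun Y : 'M[R]_(m, n) => frob_inner Y Y)
            (fun V => 2 * frob_inner X V).
Proof.
have -> : (fun Y : 'M[R]_(m, n) => frob_inner Y Y) =
    \sum_i \sum_j ((fun Y : 'M[R]_(m, n) => Y i j : R) * (fun Y => Y i j)).
  apply/funext => Y; rewrite frob_innerE fct_sumE.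
  by apply: eq_bigr => i _; rewrite fct_sumE.
apply: is_diff_eq.
  apply: is_diff_sum => i; apply: is_diff_sum => j.
  exact: is_diffM (is_diff_coord _ _ _ _ _) (is_diff_coord _ _ _ _ _).
apply/funext => V; rewrite frob_innerE fct_sumE mulr_sumr.
apply: eq_bigr => i _; rewrite fct_sumE mulr_sumr.
by apply: eq_bigr => j _; rewrite mulr_natl -mulr2n.
Qed.

Lemma is_diff_gram m n (X : 'M[R]_(m, n)) :
  is_diff X (fun Y : 'M[R]_(m, n) => Y *m Y^T)
            (fun V => X *m V^T + V *m X^T).
Proof.
have -> : (fun Y : 'M[R]_(m, n) => Y *m Y^T) = \sum_i \sum_j
    ( *:%R ^~ (delta_mx i j : 'M[R]_m) \o
      \sum_k ((fun Y : 'M[R]_(m, n) => Y i k : R) * (fun Y => Y j k))).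
  apply/funext => Y; rewrite [LHS]matrix_sum_delta fct_sumE.
  apply: eq_bigr => i _; rewrite fct_sumE; apply: eq_bigr => j _ /=.
  by rewrite fct_sumE mxE; congr (_ *: _); apply: eq_bigr => k _; rewrite !mxE.
apply: is_diff_eq.
  apply: is_diff_sum => i; apply: is_diff_sum => j; apply: is_diff_comp.
  apply: is_diff_sum => k.
  exact: is_diffM (is_diff_coord _ _ _ _ _) (is_diff_coord _ _ _ _ _).
apply/funext => V; rewrite [RHS]matrix_sum_delta fct_sumE.
apply: eq_bigr => i _; rewrite fct_sumE; apply: eq_bigr => j _ /=.
rewrite fct_sumE !mxE -big_split; congr (_ *: _).
by apply: eq_bigr => k _; rewrite !mxE; congr (_ + _); exact: mulrC.
Qed.

(** A function with Lipschitz gradient lies below its quadratic model.  The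
    derivative along the segment at [A + t (B - A)] of the difference is
    [<grad F (A + t (B - A)) - grad F A, B - A> - L t |B - A|^2], nonpositive
    by Cauchy-Schwarz and smoothness; conclude by the mean value theorem. *)
Lemma smooth_descent m n (F : 'M[R]_(m, n) -> R) (L : R) :
  (forall X, differentiable F X) -> smooth L F ->
  forall A B, F B <= F A + frob_inner (grad F A) (B - A) +
                     L / 2 * frob_inner (B - A) (B - A).
Proof.
move=> dF smF A B; set D := B - A.
pose g := frob_inner (grad F A) D; pose k := L / 2 * frob_inner D D.
pose phi := (fun t : R => F (t *: D + A)) - (g *: id + k *: (id ^+ 2)).
pose dphi t := frob_inner (grad F (t *: D + A)) D - (g + k * (2 * t)).
have phiP t : is_derive t (1 : R) phi (dphi t).
  have dline : is_diff t (fun s : R => s *: D + A) ( *:%R ^~ D).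
    have -> : (fun s : R => s *: D + A) = ( *:%R ^~ D) + cst A by [].
    apply: is_diff_eq (is_diffD (is_diff_scalel t D) (is_diff_cst A t)) _.
    by rewrite addr0.
  have dFline : is_diff t (F \o (fun s : R => s *: D + A))
      ('d F (t *: D + A) \o *:%R ^~ D).
    by apply: is_diff_comp; exact: differentiableP.
  have derF : is_derive t (1 : R) (fun s : R => F (s *: D + A))
      (frob_inner (grad F (t *: D + A)) D).
    apply: DeriveDef; first exact/diff_derivable.
    by rewrite deriveE// diff_val /= scale1r frob_inner_grad.
  have derid : is_derive t (1 : R) (id : R -> R) 1 := is_derive_id t 1.
  have derq := is_deriveD (is_deriveZ g derid)
    (is_deriveZ k (is_deriveX 2 derid)).
  apply: is_derive_eq (is_deriveB derF derq) _.
  rewrite /dphi; congr (_ - (_ + _)).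
    exact: mulr1.
  by rewrite /= expr1 /GRing.scale /= mulr1.
have [|c] := @MVT R phi dphi 0 1 ltr01 (fun t _ => phiP t).
  apply: derivable_within_continuous => t _.
  by have [] := phiP t.
rewrite in_itv /= => /andP[c0 _].
rewrite subr0 mulr1 => phi01.
have : phi 1 - phi 0 <= 0.
  rewrite phi01 /dphi /g /k -sqr_frob_norm.
  set Z := (X in grad F X).
  have := le_trans (frob_inner_le (grad F Z - grad F A) D)
    (ler_wpM2r (frob_norm_ge0 D) (smF Z A)).
  have -> : Z - A = c *: D by rewrite addrK.
  rewrite frob_normZ ?(ltW c0)// frob_innerDl frob_innerNl.
  generalize (frob_inner (grad F Z) D) (frob_inner (grad F A) D) => u v.
  lra.
have -> : phi 1 = F B - (g + k).
  rewrite /phi /= !fctE scale1r subrK.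
  by rewrite /GRing.scale /= expr1n !mulr1.
have -> : phi 0 = F A.
  rewrite /phi /= !fctE scale0r add0r.
  by rewrite /GRing.scale /= expr0n !mulr0 addr0 subr0.
rewrite /g /k; lra.
Qed.

Lemma is_diff_comp_gram n r (F : 'M[R]_n -> R) (Y : 'M[R]_(n, r)) :
  differentiable F (Y *m Y^T) ->
  is_diff Y (fun X : 'M[R]_(n, r) => F (X *m X^T))
            (fun V => 'd F (Y *m Y^T) (Y *m V^T + V *m Y^T)).
Proof.
move=> dF; have dgram := is_diff_gram _ _ Y.
have dFgram : is_diff (Y *m Y^T) F ('d F (Y *m Y^T)) by exact: differentiableP.
exact: is_diff_comp dgram dFgram.
Qed.

End Differentials.

(** * The quartic kernel *)

(** The identity
    [|t X + (1 - t) Y|^2 = t |X|^2 + (1 - t) |Y|^2 - t (1 - t) |X - Y|^2]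
    makes the quadratic term strictly convex; squaring, a nondecreasing convex
    operation on nonnegative numbers, keeps the quartic term convex. *)
Lemma strictly_convex_hN (R : realType) n r (alpha sigma : R) :
  0 < alpha -> 0 < sigma -> strictly_convex (@hN R n r alpha sigma).
Proof.
move=> alpha0 sigma0 X Y t XY /andP[t0 t1]; rewrite /hN.
rewrite -![4%N]/((2 * 2)%N) !exprM !sqr_frob_norm.
set q := frob_inner (_ + _) _; set a := frob_inner X X; set b := frob_inner Y Y.
have d0 : 0 < frob_inner (X - Y) (X - Y).
  by rewrite lt_def frob_inner_eq0 subr_eq0 XY frob_inner_ge0.
have qE : q = t * a + (1 - t) * b - t * (1 - t) * frob_inner (X - Y) (X - Y).
  rewrite /q !frob_inner_lin (frob_innerC Y X) -/a -/b; ring.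
have td0 : 0 < t * (1 - t) * frob_inner (X - Y) (X - Y).
  by rewrite !mulr_gt0// subr_gt0.
have q0 : 0 <= q by exact: frob_inner_ge0.
have qlt : q < t * a + (1 - t) * b by rewrite qE; lra.
have q2 : q ^+ 2 <= t * a ^+ 2 + (1 - t) * b ^+ 2.
  apply: (@le_trans _ _ ((t * a + (1 - t) * b) ^+ 2)).
    by rewrite ler_sqr ?nnegrE ?(le_trans q0)// ltW.
  rewrite -subr_ge0.
  have -> : t * a ^+ 2 + (1 - t) * b ^+ 2 - (t * a + (1 - t) * b) ^+ 2 =
    t * (1 - t) * (a - b) ^+ 2 by ring.
  by apply: mulr_ge0; [apply: mulr_ge0; lra|exact: sqr_ge0].
have := ler_wpM2l (ltW alpha0) q2; have := mulr_gt0 sigma0 td0.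
move: qlt; rewrite -(ltr_pM2l sigma0); lra.
Qed.

Lemma is_diff_hN (R : realType) n r (alpha sigma : R) (Y : 'M[R]_(n, r)) :
  is_diff Y (hN alpha sigma)
    (fun V => (alpha * frob_inner Y Y + sigma) * frob_inner Y V).
Proof.
pose sqn (Z : 'M[R]_(n, r)) := frob_inner Z Z.
have -> : hN alpha sigma = (alpha / 4) *: (sqn ^+ 2) + (sigma / 2) *: sqn.
  apply/funext => X; rewrite /hN -![4%N]/((2 * 2)%N) exprM sqr_frob_norm.
  by rewrite !fctE.
have dY : is_diff Y sqn _ := is_diff_frob_sqr _ _ Y.
have dh := is_diffD (is_diffZ (alpha / 4) (is_diffX 1 dY))
  (is_diffZ (sigma / 2) dY).
apply: is_diff_eq dh _.
by apply/funext => V; rewrite !fctE /= /GRing.scale /= expr1; field.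
Qed.

Lemma bregman_hN (R : realType) n r (alpha sigma : R) (X Y : 'M[R]_(n, r)) :
  let V := X - Y in
  bregman (hN alpha sigma) X Y =
    alpha / 4 * (2 * frob_inner Y V + frob_inner V V) ^+ 2 +
    (alpha * frob_inner Y Y + sigma) / 2 * frob_inner V V.
Proof.
move=> V; have dh := is_diff_hN _ n r alpha sigma Y.
rewrite /bregman frob_inner_grad diff_val.
rewrite /hN -![4%N]/((2 * 2)%N) !exprM !sqr_frob_norm -/V.
by rewrite /V !frob_inner_lin (frob_innerC X Y); field.
Qed.

(** * Increments of the Gram map *)

Lemma gram_shift (R : realType) n r (Y V : 'M[R]_(n, r)) :
  (Y + V) *m (Y + V)^T - Y *m Y^T = (Y *m V^T + V *m Y^T) + V *m V^T.
Proof.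
rewrite linearD /= mulmxDl !mulmxDr.
by rewrite -!addrA addrC !addrA subrK -!addrA.
Qed.

(** A quadratic map has no second-order error when linearised at the midpoint
    of the increment. *)
Lemma gram_shift_midpoint (R : realType) n r (Y V : 'M[R]_(n, r)) :
  let M := Y + 2^-1 *: V in
  (Y + V) *m (Y + V)^T - Y *m Y^T = M *m V^T + V *m M^T.
Proof.
rewrite /= gram_shift linearD linearZ /= mulmxDl mulmxDr -scalemxAl -scalemxAr.
rewrite addrACA -scalerDl.
by have -> : 2^-1 + 2^-1 = 1 :> R by [field]; rewrite scale1r.
Qed.

(** The midpoint form bounds the left-hand side by [4 |Y + V/2|^2 |V|^2], that
    is by [(4 y + 4 c + v) v] for [y = |Y|^2], [c = <Y, V>], [v = |V|^2].  The
    slack [3 (2 c + v)^2 - 4 c v - v^2 = 12 c^2 + 8 c v + 2 v^2] is a positive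
    definite form in [c] and [v], so a negative [c] does no harm. *)
Lemma gram_shift_le (R : realType) n r (Y V : 'M[R]_(n, r)) :
  let W := (Y + V) *m (Y + V)^T - Y *m Y^T in
  frob_inner W W <= 3 * (2 * frob_inner Y V + frob_inner V V) ^+ 2 +
                    4 * frob_inner Y Y * frob_inner V V.
Proof.
rewrite /= gram_shift_midpoint -sqr_frob_norm; set M := Y + _.
have := frob_norm_sym_le _ _ M V.
rewrite -ler_sqr ?nnegrE ?mulr_ge0 ?frob_norm_ge0// => /le_trans; apply.
rewrite !exprMn !sqr_frob_norm /M !frob_inner_lin (frob_innerC V Y).
set y := frob_inner Y Y; set c := frob_inner Y V; set v := frob_inner V V.
(* the slack is (4 (3 c + v)^2 + 2 v^2) / 3 *)
have := sqr_ge0 (3 * c + v); have := sqr_ge0 v.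
nra.
Qed.

(** * Relative smoothness *)

(** The scalar inequality to which the theorem reduces, with [y = |Y|^2],
    [c = <Y, V>], [v = |V|^2], [w = |W|^2] and [u = <g, V V^T>]. *)
Lemma quartic_budget (R : realFieldType) (L alpha sigma y c v w u : R) :
  0 <= L -> 6 * L <= alpha -> 0 <= y -> 0 <= v ->
  w <= 3 * (2 * c + v) ^+ 2 + 4 * y * v ->
  u <= (sigma / 2 + L * y) * v ->
  u + L / 2 * w <=
    alpha / 4 * (2 * c + v) ^+ 2 + (alpha * y + sigma) / 2 * v.
Proof.
move=> L0 alpha_ge y0 v0 /(ler_wpM2l L0).
have := sqr_ge0 (2 * c + v); move: (_ ^+ 2) => s s0.
have yv0 := mulr_ge0 y0 v0.
have D0 : 0 <= s / 4 + y * v / 2 by lra.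
have := ler_wpM2r D0 alpha_ge; lra.
Qed.

Theorem proposition2p1 (R : realType) (n r : nat)
    (n_ge1 : (1 <= n)%N) (r_ge1 : (1 <= r)%N) (r_le_n : (r <= n)%N)
    (F : 'M[R]_n -> R) (muF LF : R)
    (muF_ge0 : 0 <= muF) (muF_le_LF : muF <= LF)
    (F_C2 : C2 F)
    (F_strongly_convex : strongly_convex muF F)
    (F_smooth : smooth LF F)
    (alpha sigma : R) (alpha_gt0 : 0 < alpha) (sigma_gt0 : 0 < sigma)
    (alpha_ge : 6 * LF <= alpha)
    (sigma_ge : 2 * frob_norm (grad F 0) <= sigma) :
  relatively_smooth 1 (@hN R n r alpha sigma)
    (fun X : 'M[R]_(n, r) => F (X *m X^T)).
Proof.
have LF0 : 0 <= LF by exact: le_trans muF_le_LF.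
have dF : forall A, differentiable F A by case: F_C2.
have df (Y : 'M[R]_(n, r)) := is_diff_comp_gram n r F Y (dF (Y *m Y^T)).
split => //.
- split; last exact: strictly_convex_hN.
  by move=> Y; have [] := is_diff_hN _ n r alpha sigma Y.
move=> X Y; rewrite mul1r bregman_hN frob_inner_grad.
rewrite (@diff_val _ _ _ _ _ _ _ (df Y)) -frob_inner_grad.
have := smooth_descent _ _ _ _ dF F_smooth (Y *m Y^T) (X *m X^T).
set V := X - Y; have -> : X = Y + V by rewrite addrC subrK.
have := gram_shift_le _ _ _ Y V.
set W := (Y + V) *m _ - _ => /= W_le FX_le; apply: le_trans FX_le _.
set g := grad F (Y *m Y^T).
have g_le : frob_norm g <= sigma / 2 + LF * frob_inner Y Y.
  have := F_smooth (Y *m Y^T) 0; rewrite -/g subr0 => gB.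
  have -> : g = (g - grad F 0) + grad F 0 by rewrite subrK.
  have YY := frob_norm_mulmx_le _ _ _ Y Y^T.
  rewrite frob_norm_trmx -expr2 sqr_frob_norm in YY.
  have := frob_normD (g - grad F 0) (grad F 0).
  have := ler_wpM2l LF0 YY.
  lra.
have gV_le : frob_inner g (V *m V^T) <=
    (sigma / 2 + LF * frob_inner Y Y) * frob_inner V V.
  apply: le_trans (frob_inner_le _ _) _.
  apply: ler_pM; rewrite ?frob_norm_ge0//.
  apply: le_trans (frob_norm_mulmx_le _ _ _ _ _) _.
  by rewrite frob_norm_trmx -expr2 sqr_frob_norm.
have -> : frob_inner g W =
    frob_inner g (Y *m V^T + V *m Y^T) + frob_inner g (V *m V^T).
  by rewrite -frob_innerDr -gram_shift.
rewrite (addrA (F _)) -(addrA (_ + _)) lerD2l.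
apply: quartic_budget => //; exact: frob_inner_ge0.
Qed.
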